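(* Let $X$ be a distance regular graph on $n$ vertices with valency $k\ge 2$, and let $a$ be the marked vertex of $X$. Let $$A(X\backslash a)=\sum_\lambda \lambda E_\lambda$$ be the spectral decomposition of the adjacency matrix of $X\backslash a$ (the sum is over the distinct eigenvalues $\lambda$, and $E_\lambda$ is the orthogonal projection onto the $\lambda$-eigenspace). Let $v$ be any neighbor of $a$ in $X$. Then the average search probability of the quantum walk on $X$ with marked vertex $a$ is $$\frac{1}{n}\sum_\lambda \frac{k^3}{(k-\lambda)(k+\lambda)^2}\,(e_v^TE_\lambda\mathbf{1})^2+\frac{1}{n}\left(1-\sum_\lambda\frac{k}{k+\lambda}\,e_v^TE_\lambda\mathbf{1}\right)^2.$$
   Context: Graphs are finite and simple. A connected graph is distance regular if for any two vertices $u,v$ at distance $m$, the number of vertices at distance $i$ from $u$ and distance $j$ from $v$ depends only on $i,j,m$. $X\backslash a$ is $X$ with the vertex $a$ deleted; $\mathbf{1}$ is the all-ones vector and $e_v$ the standard basis vector indexed by $v$. Quantum walk: let $X$ be a $k$-regular graph on $n$ vertices with marked vertex $a$. View each edge $\{u,v\}$ as two arcs $(u,v),(v,u)$ and consider complex functions on the $nk$ arcs, identified with $\mathbb{C}^n\otimes\mathbb{C}^k$ by grouping arcs by tail. Let $R$ be the permutation matrix swapping $(u,v)$ and $(v,u)$, $C=I_n\otimes(\frac2kJ_k-I_k)$ (i.e. $(Cf)(u,v)=\frac2k\sum_{w\sim u}f(u,w)-f(u,v)$), and $O_a=(I_n-2E_{aa})\otimes I_k$ (i.e. $O_a$ multiplies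 $f(u,v)$ by $-1$ if $u=a$ and by $1$ otherwise). The transition matrix is $U=RCO_a$ and the initial state is $x_0=\frac{1}{\sqrt{nk}}\mathbf{1}_{nk}$. If $F_r$ are the orthogonal projections onto the eigenspaces of $U$ (one for each distinct eigenvalue), the average search probability is $$\sum_{v\sim a}\sum_r\big|e_{(a,v)}^TF_rx_0\big|^2,$$ which equals $\lim_{T\to\infty}\frac1T\sum_{t=0}^{T-1}\sum_{v\sim a}|e_{(a,v)}^TU^tx_0|^2$. *)

(* Defs.v *)
From mathcomp Require Import all_boot all_order all_algebra.

Set Implicit Arguments.
Unset Strict Implicit.
Unset Printing Implicit Defensive.

Import Order.TTheory GRing.Theory Num.Theory.
Local Open Scope ring_scope.

(** * Graphs: a symmetric irreflexive relation [e] on a finite type *)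

Definition simple_graph (T : finType) (e : rel T) : Prop :=
  symmetric e /\ irreflexive e.

Definition regular (T : finType) (e : rel T) (k : nat) : Prop :=
  forall u : T, #|[set v | e u v]| = k.

Definition connected (T : finType) (e : rel T) : Prop :=
  forall u v : T, connect e u v.

Definition walk (T : finType) (e : rel T) (m : nat) (u v : T) : bool :=
  [exists p : m.-tuple T, path e u p && (last u p == v)].

(* A shortest walk has fewer than [#|T|] steps; [gdist] is [#|T|] when [v] is
   not reachable from [u]. *)
Definition gdist (T : finType) (e : rel T) (u v : T) : nat :=
  find (fun m => walk e m u v) (iota 0 #|T|).

Definition distance_regular (T : finType) (e : rel T) : Prop :=
  connected e /\
  exists p : nat -> nat -> nat -> nat, forall (i j m : nat) (u v : T),
    gdist e u v = m ->
    #|[set w | (gdist e u w == i) && (gdist e v w == j)]| = p i j m.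

Definition others (T : finType) (a : T) : finType := {x : T | x != a}.

Definition del_vertex (T : finType) (e : rel T) (a : T) : rel (others a) :=
  fun u v => e (val u) (val v).

Lemma gdist_walk (T : finType) (e : rel T) (u v : T) :
  connect e u v -> walk e (gdist e u v) u v.
Proof.
move=> /connectP[p0 /shortenP[p ep up _] def_v].
have lt_p : (size p < #|T|)%N by have := max_card (mem (u :: p)); rewrite (card_uniqP up).
have has_w : has (fun m => walk e m u v) (iota 0 #|T|).
  apply/hasP; exists (size p); first by rewrite mem_iota.
  by apply/existsP; exists (in_tuple p); rewrite ep def_v eqxx.
have := nth_find 0%N has_w; rewrite nth_iota //.
by move: has_w; rewrite has_find size_iota.
Qed.

Lemma gdist_min (T : finType) (e : rel T) (u v : T) (m : nat) :
  (m < gdist e u v)%N -> ~~ walk e m u v.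
Proof.
move=> lt_m; have le_d : (gdist e u v <= #|T|)%N.
  by have := find_size (fun m => walk e m u v) (iota 0 #|T|); rewrite size_iota.
have := before_find 0%N lt_m.
by rewrite nth_iota ?add0n ?(leq_trans lt_m) // => ->.
Qed.

(** * Vectors and matrices indexed by a finite type, via [enum_rank] *)

Definition fmx (C : numClosedFieldType) (S : finType) (f : S -> S -> C) :
    'M[C]_#|S| :=
  \matrix_(i, j) f (enum_val i) (enum_val j).

(* [entry x s] is $e_s^T x$. *)
Definition entry (C : numClosedFieldType) (S : finType) (x : 'cV[C]_#|S|)
    (s : S) : C :=
  x (enum_rank s) 0.

Definition adjacency (C : numClosedFieldType) (S : finType) (e : rel S) :
    'M[C]_#|S| :=
  fmx (fun u v => (e u v)%:R).

(** * Spectral decomposition *)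

(* The distinct eigenvalues, each listed once. *)
Definition eigenvalues (C : numClosedFieldType) (n : nat) (M : 'M[C]_n) : seq C :=
  undup (sval (closed_field_poly_normal (char_poly M))).

(* Orthogonal (for the Hermitian form) projection onto [{x | M *m x = mu *: x}].
   The library's [eigenspace] and [proj_ortho] are about row vectors, hence the
   transpositions. *)
Definition eigenproj (C : numClosedFieldType) (n : nat) (M : 'M[C]_n) (mu : C) :
    'M[C]_n :=
  (proj_ortho (eigenspace M^T mu))^T.

Lemma mem_eigenvalues (C : numClosedFieldType) (n : nat) (M : 'M[C]_n) :
  eigenvalues M =i eigenvalue M.
Proof.
move=> mu; rewrite mem_undup -[RHS]/(eigenvalue M mu) eigenvalue_root_char.
case: closed_field_poly_normal => /= r def_p.
by rewrite def_p (monicP (char_poly_monic M)) scale1r root_prod_XsubC.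
Qed.

Lemma eigenproj_eigen (C : numClosedFieldType) (n : nat) (M : 'M[C]_n) (mu : C)
    (x : 'cV[C]_n) :
  M *m (eigenproj M mu *m x) = mu *: (eigenproj M mu *m x).
Proof.
apply: trmx_inj; rewrite linearZ /= !trmx_mul trmxK.
by apply/eigenspaceP; apply: proj_ortho_sub.
Qed.

Lemma eigenproj_ortho (C : numClosedFieldType) (n : nat) (M : 'M[C]_n) (mu : C)
    (x y : 'cV[C]_n) :
  M *m y = mu *: y ->
  (x - eigenproj M mu *m x)^T *m map_mx Num.conj y = 0.
Proof.
move=> My; rewrite linearB /= trmx_mul trmxK.
have yE : (y^T <= eigenspace M^T mu)%MS.
  by apply/eigenspaceP; rewrite -trmx_mul My linearZ.
have := proj_ortho_compl_sub (eigenspace M^T mu) x^T.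
rewrite orthomx_sym => /(submx_trans yE); rewrite orthomx_sym.
by move=> /orthomx1P; rewrite trmxK.
Qed.

(** * The quantum walk: complex functions on arcs, indexed by (tail, head) *)

Definition arc (T : finType) (e : rel T) : finType := {p : T * T | e p.1 p.2}.

Definition tail (T : finType) (e : rel T) (p : arc e) : T := (val p).1.
Definition head (T : finType) (e : rel T) (p : arc e) : T := (val p).2.

Definition arc_reversal (C : numClosedFieldType) (T : finType) (e : rel T) :
    'M[C]_#|arc e| :=
  fmx (fun p q => ((tail p == head q) && (head p == tail q))%:R).

Definition coin (C : numClosedFieldType) (T : finType) (e : rel T) (k : nat) :
    'M[C]_#|arc e| :=
  fmx (fun p q => (tail p == tail q)%:R * (2%:R / k%:R) - (p == q)%:R).

Definition oracle (C : numClosedFieldType) (T : finType) (e : rel T) (a : T) :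
    'M[C]_#|arc e| :=
  fmx (fun p q => (p == q)%:R * (if tail p == a then -1 else 1)).

Definition transition (C : numClosedFieldType) (T : finType) (e : rel T)
    (k : nat) (a : T) : 'M[C]_#|arc e| :=
  arc_reversal C e *m coin C e k *m oracle C e a.

Definition initial_state (C : numClosedFieldType) (T : finType) (e : rel T)
    (k : nat) : 'cV[C]_#|arc e| :=
  (sqrtC (#|T| * k)%:R)^-1 *: const_mx 1.

Definition avg_search_prob (C : numClosedFieldType) (T : finType) (e : rel T)
    (k : nat) (a : T) : C :=
  let U := transition C e k a in
  \sum_(p : arc e | tail p == a)
    \sum_(mu <- eigenvalues U)
      `|entry (eigenproj U mu *m initial_state C e k) p| ^+ 2.

(* Main.v *)
Require Import Defs.
From mathcomp Require Import all_boot all_order all_algebra.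
From mathcomp Require Import ring.
(* Arcs, heads and tails below are those of the graph, not those of paths and
   sequences. *)
Import Defs.

(** The walk [U] and the adjacency matrix [A] of the graph without [a] share
    their spectral data.  Write [g_l = E_l 1] for the [l]-component of the
    all-ones vector, extended by 0 at [a], and look at the two arc functions
    [g_l (tail p)] and [g_l (head p)].  Since [g_l] vanishes at [a], is constant
    on the neighbours of [a], and has neighbour sums [l * g_l u] at every other
    vertex [u], these two functions span a [U]-invariant space, on which [U] has
    the eigenvalues [z], [z^*] with [|z| = 1] and [z + z^* = 2 l / k]; the
    eigenvectors are [g_l (tail p) - z * g_l (head p)] ([transition_eigen],
    [phase]).

    What remains of the all-ones arc function after subtracting
    [sum_l k / (k + l) * (g_l (tail p) + g_l (head p))] is symmetric under arc
    reversal, and its sum over the arcs leaving any vertex other than [a] is 0;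
    [U] acts on it as [-1] ([transition_eigenN1]).  This splits the initial state
    into eigenvectors of [U] for distinct eigenvalues.  As [U] is unitary, they
    are pairwise orthogonal, so the eigenprojections of the initial state are
    exactly these pieces ([sum_over_eigencomponents]).  At an arc leaving [a] the
    [-1]-piece has the entry [1 - sum_l k / (k + l) * g_l v], and the two pieces
    belonging to [l] have squared moduli that add up to
    [k / (k - l) * (k / (k + l) * g_l v) ^ 2] ([norm_amplitude]); all this
    divided by the squared norm [n * k] of the all-ones function.  Summing over
    the [k] arcs leaving [a] gives the formula.

    Two more facts about the graph enter.  Connectivity gives [- k < l < k], through
    the Dirichlet forms of [g] and of its signless analogue
    ([eigenvalue_bound]), so that no denominator vanishes and the phases are
    distinct.  Distance regularity makes the functions of the distance to [a]
    stable under [A]; the components [g_l] of the all-ones vector are polynomials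
    in [A] applied to it, so they depend on the distance only, and in particular
    are constant on the neighbours of [a] ([radial_eigenproj]). *)

Set Implicit Arguments.
Unset Strict Implicit.
Unset Printing Implicit Defensive.

Import Order.TTheory GRing.Theory Num.Theory.
Local Open Scope ring_scope.
Local Open Scope sesquilinear_scope.

(** * Eigenprojections of normal matrices *)

Section Normal.
Variables (C : numClosedFieldType) (n : nat).
Implicit Types (M : 'M[C]_n).

Lemma trmxC_mul m p q (A : 'M[C]_(m, p)) (B : 'M[C]_(p, q)) :
  (A *m B)^t* = B^t* *m A^t*.
Proof. by rewrite trmx_mul map_mxM. Qed.

Lemma trmxC_mul_eq0 p (X : 'M[C]_(n, p)) : X^t* *m X = 0 -> X = 0.
Proof.
move=> X0; apply/matrixP => i j; rewrite mxE.
move/matrixP/(_ j j)/eqP: X0; rewrite !mxE psumr_eq0 => [|l _].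
  by move=> /allP/(_ i (mem_index_enum i)); rewrite !mxE mulrC mul_conjC_eq0 => /eqP.
by rewrite !mxE mulrC mul_conjC_ge0.
Qed.

(** [M^t* Y] and [M Y] have the same Gram matrix when [M] commutes with
    [M^t*]. *)
Lemma normalmx_ker M p (Y : 'M[C]_(n, p)) :
  M \is normalmx -> M *m Y = 0 -> M^t* *m Y = 0.
Proof.
move=> /normalmxP nM MY; apply: trmxC_mul_eq0.
by rewrite trmxC_mul trmxCK -mulmxA (mulmxA M) nM -mulmxA MY !mulmx0.
Qed.

(** The matrix [M - mu] is again normal, so its kernel is killed by its
    adjoint. *)
Lemma normalmx_adjoint_eigen M mu p (Y : 'M[C]_(n, p)) : M \is normalmx ->
  M *m Y = mu *: Y -> M^t* *m Y = mu^* *: Y.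
Proof.
move=> nM MY; have adjB : (M - mu%:M)^t* = M^t* - mu^*%:M.
  by apply/matrixP => i j; rewrite !mxE rmorphB rmorphMn /= eq_sym.
have nB : M - mu%:M \is normalmx.
  apply/normalmxP; rewrite adjB !mulmxBl !mulmxBr (normalmxP nM).
  rewrite !mul_mx_scalar !mul_scalar_mx !scale_scalar_mx (mulrC mu).
  by apply/matrixP => i j; rewrite !mxE; ring.
apply/eqP; rewrite -subr_eq0 -mul_scalar_mx -mulmxBl -adjB.
by rewrite normalmx_ker // mulmxBl MY mul_scalar_mx subrr.
Qed.

Lemma normalmx_eigen_ortho M mu nu p q (Y : 'M[C]_(n, p)) (Z : 'M[C]_(n, q)) :
  M \is normalmx -> mu != nu ->
  M *m Y = mu *: Y -> M *m Z = nu *: Z -> Y^t* *m Z = 0.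
Proof.
move=> nM neq MY MZ; apply/eqP.
have E : Y^t* *m (M *m Z) = mu *: (Y^t* *m Z).
  rewrite mulmxA -[Y^t* *m M]trmxCK trmxC_mul trmxCK (normalmx_adjoint_eigen nM MY).
  by rewrite linearZ /= map_mxZ /= conjCK -scalemxAl.
move/eqP: E; rewrite MZ -scalemxAr -subr_eq0 -scalerBl scaler_eq0 subr_eq0 eq_sym.
by rewrite (negPf neq).
Qed.

Lemma eigenproj_id M mu (y : 'cV[C]_n) : M *m y = mu *: y -> eigenproj M mu *m y = y.
Proof.
move=> My; apply: trmx_inj; rewrite trmx_mul trmxK proj_ortho_id //.
by apply/eigenspaceP; rewrite -trmx_mul My linearZ.
Qed.

Lemma eigenproj_eq0 M mu nu (y : 'cV[C]_n) : M \is normalmx -> mu != nu ->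
  M *m y = nu *: y -> eigenproj M mu *m y = 0.
Proof.
move=> nM neq My; apply: trmx_inj; rewrite trmx_mul trmxK trmx0 proj_ortho_0 //.
set S := eigenspace _ _.
have MS : M *m S^T = mu *: S^T.
  apply: trmx_inj; rewrite trmx_mul linearZ /= !trmxK.
  exact/eigenspaceP.
rewrite orthomx1E; apply/eqP/trmx_inj; rewrite trmx0 trmx_mul trmxK.
by have := normalmx_eigen_ortho nM neq MS My; rewrite trmxK map_trmx trmxK.
Qed.

(** The vectors are the components of [x] in the orthonormal eigenbasis of
    the spectral theorem; several of them may share an eigenvalue. *)
Lemma spectral_decomposition M x : M \is normalmx ->
  exists nu : 'I_n -> C, exists2 y : 'I_n -> 'cV[C]_n,
    forall i, M *m y i = nu i *: y i & x = \sum_i y i.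
Proof.
move=> nM; have PP := spectral_unitarymx M; set P := spectralmx M in PP.
have def_M : M = invmx P *m diag_mx (spectral_diag M) *m P by apply/orthomx_spectralP.
have uP := unitarymx_unit PP.
exists (fun i => spectral_diag M 0 i).
exists (fun i => invmx P *m (delta_mx i i *m (P *m x))) => [i|].
  rewrite {1}def_M -!mulmxA (mulKVmx uP) (mulmxA (diag_mx _)) scalemxAr scalemxAl.
  congr (_ *m (_ *m _)); apply/matrixP => r s.
  by rewrite mul_diag_mx !mxE; have [-> | _] := eqVneq r i; rewrite ?mulr0.
by rewrite -mulmx_sumr -mulmx_suml -mx1_sum_delta mul1mx mulKmx.
Qed.

Lemma char_poly_trmx M : char_poly M^T = char_poly M.
Proof.
by rewrite /char_poly -det_tr /char_poly_mx linearB /= tr_scalar_mx map_trmx trmxK.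
Qed.

(** Membership in the list of eigenvalues refers to row eigenvectors;
    transposition does not change the characteristic polynomial. *)
Lemma eigenvector_mem M mu (y : 'cV[C]_n) : M *m y = mu *: y -> y != 0 ->
  mu \in eigenvalues M.
Proof.
move=> My y0; rewrite mem_eigenvalues.
have : eigenvalue M^T mu.
  apply/eigenvalueP; exists y^T; first by rewrite -trmx_mul My linearZ.
  by apply: contra_neq y0 => /(congr1 trmx); rewrite trmxK trmx0.
by rewrite eigenvalue_root_char char_poly_trmx -eigenvalue_root_char.
Qed.

Lemma sum_eigenproj M (x : 'cV[C]_n) : M \is normalmx ->
  \sum_(mu <- eigenvalues M) eigenproj M mu *m x = x.
Proof.
move=> nM; have [nu [y My ->]] := spectral_decomposition x nM.
under eq_bigr => mu _ do rewrite mulmx_sumr.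
rewrite exchange_big /=; apply: eq_bigr => i _.
have [-> | y0] := eqVneq (y i) 0; first by rewrite big1 // => mu; rewrite mulmx0.
rewrite (bigD1_seq (nu i)) ?undup_uniq ?(eigenvector_mem (My i)) //=.
rewrite eigenproj_id // big1 ?addr0 // => mu neq.
by rewrite (eigenproj_eq0 nM neq).
Qed.

(** For a normal matrix, any splitting of a vector into eigenvectors for
    distinct eigenvalues is the orthogonal one.  Since some pieces may vanish
    and some eigenvalues of [M] may be absent from [s], the two sums are compared
    through a function [G] with [G 0 = 0]. *)
Lemma sum_over_eigencomponents (I : eqType) (s : seq I) M (nu : I -> C)
    (y : I -> 'cV[C]_n) (V : nmodType) (G : 'cV[C]_n -> V) :
  M \is normalmx -> uniq s -> {in s &, injective nu} ->
  {in s, forall i, M *m y i = nu i *: y i} -> G 0 = 0 ->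
  \sum_(mu <- eigenvalues M) G (eigenproj M mu *m \sum_(i <- s) y i)
    = \sum_(i <- s) G (y i).
Proof.
move=> nM us inj My G0.
have projE i : i \in s -> eigenproj M (nu i) *m (\sum_(j <- s) y j) = y i.
  move=> si; rewrite mulmx_sumr (bigD1_seq i) //= eigenproj_id ?My //.
  rewrite big1_seq ?addr0 // => j /andP[ne sj].
  rewrite (eigenproj_eq0 nM _ (My j sj)) //.
  by apply: contra_neq ne => /esym; apply: inj.
rewrite (bigID [pred mu | mu \in map nu s]) /= [X in _ + X]big1_seq ?addr0; last first.
  move=> mu /andP[ms _]; rewrite mulmx_sumr big1_seq ?G0 // => i /andP[_ si].
  rewrite (eigenproj_eq0 nM _ (My i si)) //.
  by apply: contra ms => /eqP ->; apply: map_f.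
rewrite [RHS](bigID (fun i => nu i \in eigenvalues M)) /=.
rewrite [X in _ = _ + X]big1_seq ?addr0; last first.
  move=> i /andP[nui si]; have [-> // | y0] := eqVneq (y i) 0.
  by rewrite (eigenvector_mem (My i si)) in nui.
rewrite -[RHS]big_filter -[LHS]big_filter.
have -> : \sum_(i <- [seq i <- s | nu i \in eigenvalues M]) G (y i) =
   \sum_(i <- [seq i <- s | nu i \in eigenvalues M])
      G (eigenproj M (nu i) *m \sum_(j <- s) y j).
  by apply: eq_big_seq => i; rewrite mem_filter => /andP[_ /projE ->].
rewrite -(big_map nu predT (fun mu => G (eigenproj M mu *m _))).
apply: perm_big; apply: uniq_perm.
- by rewrite filter_uniq // undup_uniq.
- rewrite map_inj_in_uniq ?filter_uniq // => i j.
  by rewrite !mem_filter => /andP[_ si] /andP[_ sj]; apply: inj.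
move=> mu; rewrite mem_filter; apply/andP/mapP => [[/mapP[i si ->] mi]|[i]].
  by exists i; rewrite // mem_filter mi.
by rewrite mem_filter => /andP[mi si ->]; rewrite map_f.
Qed.

(** An eigencomponent of [x] is a polynomial in [M] applied to [x], with
    coefficients in the field generated by the eigenvalues.  Here the Lagrange
    interpolation is replaced by an induction: [M - l0] removes the component
    at [l0] and rescales the others. *)
Lemma eigencomponent_stable (P : 'cV[C]_n -> Prop) M
    (s : seq C) (y : C -> 'cV[C]_n) :
  (forall x z, P x -> P z -> P (x + z)) ->
  (forall c x, c \is Num.real -> P x -> P (c *: x)) ->
  (forall x, P x -> P (M *m x)) ->
  uniq s -> {in s, forall l, l \is Num.real} ->
  {in s, forall l, M *m y l = l *: y l} ->
  P (\sum_(l <- s) y l) -> {in s, forall l, P (y l)}.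
Proof.
move=> PD PZ PM.
elim: s y => [//|l0 s IHs] y /= /andP[l0s us] rs My Py.
have Pl : {in s, forall l, P (y l)}.
  move=> l sl; have ne : l - l0 != 0.
    by rewrite subr_eq0; apply: contraNneq l0s => <-.
  have rl j : j \in s -> j - l0 \is Num.real.
    by move=> sj; rewrite realB ?rs ?mem_head // inE sj orbT.
  suff : P ((l - l0) *: y l).
    move=> /(PZ (l - l0)^-1); rewrite scalerA mulVf // scale1r; apply.
    by rewrite realV rl.
  pose z j := (j - l0) *: y j.
  rewrite -[_ *: _]/(z l).
  apply: (IHs z us _ _ _ l sl) => [j sj|j sj|]; first by rewrite rs // inE sj orbT.
    by rewrite /z -scalemxAr My ?inE ?sj ?orbT // !scalerA mulrC.
  have -> : \sum_(j <- s) z j =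
      M *m (\sum_(j <- l0 :: s) y j) + (- l0) *: \sum_(j <- l0 :: s) y j.
    rewrite !big_cons mulmxDr My ?mem_head // scalerDr addrACA -scalerDl subrr scale0r.
    rewrite add0r mulmx_sumr scaler_sumr -big_split; apply: eq_big_seq => j sj /=.
    by rewrite My ?inE ?sj ?orbT // -scalerDl.
  by apply: PD; [apply: PM | apply: PZ; rewrite // realN rs ?mem_head].
move=> l; rewrite inE => /predU1P[-> | /Pl //].
have P0 : P 0 by rewrite -(scale0r (\sum_(j <- l0 :: s) y j)); apply: (PZ).
have := Py; rewrite big_cons => Py0.
have -> : y l0 = (y l0 + \sum_(j <- s) y j) + (-1) *: \sum_(j <- s) y j.
  by rewrite scaleN1r addrK.
apply: (PD) => //; apply: PZ; first by rewrite realN real1.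
by rewrite big_seq; apply: (big_ind P).
Qed.

End Normal.

(** * Vectors and matrices indexed by a finite type *)

Section Indexed.
Variables (C : numClosedFieldType) (S : finType).

Lemma sum_delta (F : S -> C) s : \sum_t (s == t)%:R * F t = F s.
Proof.
rewrite (bigD1 s) //= eqxx mul1r big1 ?addr0 // => t.
by rewrite eq_sym => /negPf ->; rewrite mul0r.
Qed.

Lemma sum_deltar (F : S -> C) s : \sum_t F t * (t == s)%:R = F s.
Proof. by rewrite -[RHS]sum_delta; apply: eq_bigr => t _; rewrite mulrC eq_sym. Qed.

Definition vec (f : S -> C) : 'cV[C]_#|S| := \col_i f (enum_val i).

Lemma entry_vec f s : entry (vec f) s = f s.
Proof. by rewrite /entry mxE enum_rankK. Qed.

Lemma entry_inj (x y : 'cV[C]_#|S|) : entry x =1 entry y -> x = y.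
Proof.
by move=> xy; apply/colP => i; have := xy (enum_val i); rewrite /entry enum_valK.
Qed.

Lemma entry_fmx (f : S -> S -> C) x s :
  entry (fmx f *m x) s = \sum_t f s t * entry x t.
Proof.
rewrite /entry mxE [RHS]big_enum_val /=; apply: eq_bigr => i _.
by rewrite mxE enum_rankK enum_valK.
Qed.

Lemma entryD (x y : 'cV[C]_#|S|) s : entry (x + y) s = entry x s + entry y s.
Proof. by rewrite /entry mxE. Qed.

Lemma entryZ c (x : 'cV[C]_#|S|) s : entry (c *: x) s = c * entry x s.
Proof. by rewrite /entry mxE. Qed.

Lemma entry0 s : entry (0 : 'cV[C]_#|S|) s = 0.
Proof. by rewrite /entry mxE. Qed.

Lemma entry_sum I (r : seq I) (x : I -> 'cV[C]_#|S|) s :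
  entry (\sum_(i <- r) x i) s = \sum_(i <- r) entry (x i) s.
Proof. by rewrite /entry summxE. Qed.

Lemma entry_const (c : C) s : entry (const_mx c : 'cV[C]_#|S|) s = c.
Proof. by rewrite /entry mxE. Qed.

Lemma fmx_unitary (f : S -> S -> C) :
  (forall s t, f s t \is Num.real) -> (forall s t, f s t = f t s) ->
  (forall s t, \sum_u f s u * f u t = (s == t)%:R) -> fmx f \is unitarymx.
Proof.
move=> fR fS ff; apply/unitarymxP/matrixP => i j; rewrite !mxE.
rewrite -[RHS](congr1 (fun b : bool => b%:R) (inj_eq enum_val_inj i j)) -ff.
rewrite [RHS]big_enum_val /=; apply: eq_bigr => l _.
by rewrite !mxE (CrealP (fR _ _)) fS [X in _ * X]fS [X in X * _]fS.
Qed.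

End Indexed.

(** * The walk on arcs *)

Section Arcs.
Variables (C : numClosedFieldType) (T : finType) (e : rel T) (k : nat) (a : T).
Hypotheses (simple_e : simple_graph e) (reg_e : regular e k) (k_gt0 : (0 < k)%N).

Lemma sum_tail (V : nmodType) u (F : T -> V) :
  \sum_(q : arc e | tail q == u) F (head q) = \sum_(w | e u w) F w.
Proof.
rewrite /tail /head.
pose P := [pred p : T * T | e p.1 p.2].
transitivity (\sum_(p : T * T | P p && (p.1 == u)) F p.2).
  rewrite [RHS]big_sub_cond.
  by apply: eq_bigl => p.
rewrite -(pair_big_dep xpredT (fun x w => e x w && (x == u)) (fun x w => F w)) /=.
rewrite (bigD1 u) //= [X in _ + X]big1 ?addr0; first
  by apply: eq_bigl => w; rewrite eqxx andbT.
by move=> w wu; rewrite big1 // => w'; rewrite (negPf wu) andbF.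
Qed.

Lemma rev_arc_subproof (p : arc e) : e (head p) (tail p).
Proof. by case: simple_e => es _; rewrite es; exact: valP p. Qed.

Definition rev_arc (p : arc e) : arc e :=
  exist (fun p => e p.1 p.2) (head p, tail p) (rev_arc_subproof p).

Lemma arc_eqE (p q : arc e) : (p == q) = (tail p == tail q) && (head p == head q).
Proof. by []. Qed.

Lemma rev_arc_eqE (p q : arc e) :
  (q == rev_arc p) = (tail p == head q) && (head p == tail q).
Proof. by rewrite arc_eqE andbC [head q == _]eq_sym [tail q == _]eq_sym. Qed.

Lemma card_tail u : #|[pred q : arc e | tail q == u]| = k.
Proof.
rewrite -sum1_card (sum_tail u (fun=> 1%N)) sum1_card -(reg_e u).
by apply: eq_card => w; rewrite !inE.
Qed.

Lemma natr_valency_neq0 : k%:R != 0 :> C.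
Proof. by rewrite pnatr_eq0 -lt0n. Qed.

Lemma arc_reversal_unitary : arc_reversal C e \is unitarymx.
Proof.
apply: fmx_unitary => [p q|p q|p q].
- exact: realn.
- by rewrite [tail q == _]eq_sym [head q == _]eq_sym andbC.
- rewrite (bigD1 (rev_arc p)) //= big1 => [|r]; last first.
    by rewrite rev_arc_eqE => /negPf->; rewrite mul0r.
  by rewrite addr0 -rev_arc_eqE eqxx mul1r arc_eqE andbC.
Qed.

Lemma coin_unitary : coin C e k \is unitarymx.
Proof.
have k0 := natr_valency_neq0.
apply: fmx_unitary => [p q|p q|p q].
- by rewrite realB ?realM ?realV ?realn.
- by rewrite eq_sym [p == q]eq_sym.
under eq_bigr => r _ do rewrite mulrBl !mulrBr.
rewrite !sumrB !sum_delta sum_deltar.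
have -> : \sum_(r : arc e) (tail p == tail r)%:R * (2 / k%:R) *
    ((tail r == tail q)%:R * (2 / k%:R)) = (tail p == tail q)%:R * (4 / k%:R) :> C.
  transitivity (\sum_(r : arc e | tail r == tail p)
    (tail p == tail q)%:R * (2 / k%:R) ^+ 2 : C).
    rewrite [RHS]big_mkcond; apply: eq_bigr => r _; rewrite eq_sym.
    by case: eqP => [->|_]; rewrite ?mul0r //= mul1r mulrCA expr2.
  by rewrite sumr_const card_tail -mulr_natl; field.
by field.
Qed.

Lemma oracle_unitary : oracle C e a \is unitarymx.
Proof.
apply: fmx_unitary => [p q|p q|p q].
- by rewrite realM ?realn //; case: ifP; rewrite ?realN real1.
- by rewrite eq_sym; case: eqP => [->|]; rewrite ?mul0r.
- rewrite (bigD1 p) //= big1 ?addr0 => [|r]; last first.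
    by rewrite eq_sym => /negPf ->; rewrite !mul0r.
  by rewrite eqxx mul1r mulrCA; case: ifP => _; rewrite ?mulrNN !mulr1.
Qed.

Lemma transition_normal : transition C e k a \is normalmx.
Proof.
have uU : transition C e k a \is unitarymx.
  by rewrite !mul_unitarymx ?arc_reversal_unitary ?coin_unitary ?oracle_unitary.
apply/normalmxP; rewrite (unitarymxP uU).
by rewrite -(invmx_unitary uU) mulVmx // unitarymx_unit.
Qed.

(** One step of the walk: pass to the reversed arc, reflect about the average
    over the arcs leaving its tail, and change the sign if that tail is [a]. *)
Lemma transition_vec (F : T -> T -> C) (p : arc e) :
  entry (transition C e k a *m vec (fun q : arc e => F (tail q) (head q))) p =
    (if head p == a then -1 else 1) *
      (2 / k%:R * (\sum_(w | e (head p) w) F (head p) w) - F (head p) (tail p)).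
Proof.
set x := vec _; have xE q : entry x q = F (tail q) (head q) by rewrite entry_vec.
rewrite /transition -!mulmxA entry_fmx.
under eq_bigr => q _ do rewrite -rev_arc_eqE eq_sym.
rewrite sum_delta entry_fmx.
have E q : entry (oracle C e a *m x) q =
   (if tail q == a then -1 else 1) * F (tail q) (head q).
  rewrite entry_fmx; under eq_bigr => r _ do rewrite -mulrA.
  by rewrite sum_delta xE.
under eq_bigr => q _ do rewrite E mulrBl.
rewrite sumrB sum_delta mulrBr; congr (_ - _).
rewrite -(sum_tail (head p) (F (head p))) mulrA mulr_sumr [RHS]big_mkcond.
apply: eq_bigr => q _; rewrite eq_sym.
rewrite -[tail (rev_arc p)]/(head p).
by case: eqP => [->|_]; rewrite ?mul0r //= mul1r mulrCA mulrA.
Qed.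

End Arcs.

(** * Distance in a graph *)

Section Distance.
Variables (T : finType) (e : rel T).

Lemma walk0 u w : walk e 0 u w = (u == w).
Proof.
apply/existsP/eqP => [[p]|->]; last by exists [tuple]; rewrite /= eqxx.
by rewrite [p]tuple0 /= => /eqP.
Qed.

Lemma walk1 u w : walk e 1 u w = e u w.
Proof.
apply/existsP/idP => [[[[|x []] //= _]]|euw].
  by rewrite andbT => /andP[ex /eqP <-].
by exists [tuple w]; rewrite /= euw eqxx.
Qed.

Lemma gdist_eq0 u w : connected e -> (gdist e u w == 0%N) = (u == w).
Proof.
move=> ce; apply/eqP/eqP => [d0|->]; first by apply/eqP; rewrite -walk0 -d0 gdist_walk.
apply/eqP; rewrite -leqn0 leqNgt; apply/negP => /gdist_min.
by rewrite walk0 eqxx.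
Qed.

Lemma gdist_eq1 u w : simple_graph e -> connected e -> (gdist e u w == 1%N) = e u w.
Proof.
move=> [_ ie] ce; apply/eqP/idP => [d1|euw]; first by rewrite -walk1 -d1 gdist_walk.
apply/eqP; rewrite eqn_leq lt0n gdist_eq0 // andbC; apply/andP; split.
  by apply: contraTneq euw => ->; rewrite ie.
by rewrite leqNgt; apply/negP => /gdist_min; rewrite walk1 euw.
Qed.

Lemma gdist_le u w : (gdist e u w <= #|T|)%N.
Proof. by rewrite -[X in (_ <= X)%N](size_iota 0) find_size. Qed.

End Distance.

(** * The graph without the marked vertex *)

Section Deleted.
Variables (C : numClosedFieldType) (T : finType) (e : rel T) (k : nat) (a : T).
Hypotheses (simple_e : simple_graph e) (conn_e : connected e)
  (reg_e : regular e k).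

Implicit Types (x : 'cV[C]_#|others a|) (l : C).

Local Notation A := (adjacency C (del_vertex e (a := a))).

(** Extending by 0 at [a] lets neighbour sums in the graph without [a] be
    written as neighbour sums in the whole graph. *)
Definition ext0 (x : 'cV[C]_#|others a|) (u : T) : C :=
  oapp (entry x) 0 (insub u).

Lemma ext0_marked x : ext0 x a = 0.
Proof. by rewrite /ext0 insubF ?eqxx. Qed.

Lemma ext0_val x s : ext0 x (val s) = entry x s.
Proof. by rewrite /ext0 valK. Qed.

Lemma sum_others (V : nmodType) (F : T -> V) :
  \sum_(s : others a) F (val s) = \sum_(w | w != a) F w.
Proof. by symmetry; exact: (big_sub (predC1 a) F). Qed.

Lemma adjacency_entry x s : entry (A *m x) s = \sum_(w | e (val s) w) ext0 x w.
Proof.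
rewrite entry_fmx.
under eq_bigr => t _ do rewrite -ext0_val.
rewrite (sum_others (fun w => (e (val s) w)%:R * ext0 x w)).
rewrite [RHS]big_mkcond [RHS](bigD1 a) //= ext0_marked if_same add0r.
by apply: eq_bigr => w _; case: (e _ w); rewrite ?mul1r ?mul0r.
Qed.

Lemma ext0_eigen x l u : A *m x = l *: x -> u != a ->
  \sum_(w | e u w) ext0 x w = l * ext0 x u.
Proof.
move=> Ax ua; have := adjacency_entry x (exist (fun w => w != a) u ua).
by rewrite Ax entryZ -ext0_val.
Qed.

Lemma adjacency_trC : A^t* = A.
Proof.
apply/matrixP => i j; rewrite !mxE conjC_nat.
by case: simple_e => es _; rewrite /del_vertex es.
Qed.

Lemma adjacency_normal : A \is normalmx.
Proof. by apply/normalmxP; rewrite adjacency_trC. Qed.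

Lemma ext0_eq0 x : (forall u, ext0 x u = 0) -> x = 0.
Proof.
by move=> x0; apply: entry_inj => s; rewrite -ext0_val x0 entry0.
Qed.

Lemma eigen_real x l : A *m x = l *: x -> x != 0 -> l \is Num.real.
Proof.
move=> Ax x0; apply/CrealP/eqP.
have := normalmx_adjoint_eigen adjacency_normal Ax; rewrite adjacency_trC Ax.
by move/eqP; rewrite -subr_eq0 -scalerBl scaler_eq0 (negPf x0) orbF subr_eq0 eq_sym.
Qed.

(** Expanding the squares, the diagonal terms count each vertex [k] times
    (also at [a], where the extension is 0), and the cross terms are evaluated
    by the eigenvalue equation.  The sign [b] treats [k - l] and [k + l]
    together. *)
Lemma dirichlet_form x l (b : bool) : A *m x = l *: x -> l \is Num.real ->
  \sum_u \sum_(w | e u w) `|ext0 x u - (-1) ^+ b * ext0 x w| ^+ 2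
    = 2 * (k%:R - (-1) ^+ b * l) * \sum_u `|ext0 x u| ^+ 2.
Proof.
move=> Ax lR; set G := ext0 x; set sg : C := (-1) ^+ b.
set N := \sum_u `|G u| ^+ 2.
have sgC : sg^* = sg by rewrite rmorphXn /= rmorphN1.
have sg2 : sg * sg = 1 by rewrite -expr2 sqrr_sign.
have cross : \sum_u \sum_(w | e u w) (G u)^* * G w = l * N.
  rewrite mulr_sumr; apply: eq_bigr => u _; rewrite -mulr_sumr.
  have [-> | ua] := eqVneq u a.
    by rewrite /G ext0_marked rmorph0 normr0 expr0n mulr0 mul0r.
  by rewrite (ext0_eigen Ax ua) -/(G u) normCKC; ring.
have crossC : \sum_u \sum_(w | e u w) G u * (G w)^* = l * N.
  have -> : l * N = (l * N)^*.
    by rewrite rmorphM /= (CrealP lR) (CrealP _) // ger0_real // sumr_ge0 // => u _;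
       rewrite exprn_ge0.
  rewrite -cross rmorph_sum; apply: eq_bigr => u _; rewrite rmorph_sum.
  by apply: eq_bigr => w _; rewrite rmorphM /= conjCK.
have diag1 : \sum_u \sum_(w | e u w) `|G u| ^+ 2 = k%:R * N.
  rewrite mulr_sumr; apply: eq_bigr => u _; rewrite sumr_const mulr_natl.
  by rewrite -(reg_e u); congr (_ *+ _); apply: eq_card => w; rewrite !inE.
have diag2 : \sum_u \sum_(w | e u w) `|G w| ^+ 2 = k%:R * N.
  rewrite (exchange_big_dep xpredT) //= -diag1; apply: eq_bigr => u _.
  by apply: eq_bigl => w; case: simple_e.
have -> : 2 * (k%:R - sg * l) * N = k%:R * N + k%:R * N - sg * (l * N) - sg * (l * N).
  by ring.
rewrite -{1}diag1 -diag2 -{1}cross -crossC.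
rewrite !mulr_sumr -!big_split -!sumrB; apply: eq_bigr => u _.
rewrite !mulr_sumr -!big_split -!sumrB; apply: eq_bigr => w _ /=.
rewrite !normCK rmorphB rmorphM /= sgC.
transitivity (G u * (G u)^* + sg * sg * (G w * (G w)^*)
  - sg * ((G u)^* * G w) - sg * (G u * (G w)^*)).
  by ring.
by rewrite sg2 mul1r.
Qed.

(** The Dirichlet form is nonnegative, and if it vanished, [|ext0 x|] would be
    constant along the edges, hence 0 everywhere as it is 0 at [a] and the graph
    is connected. *)
Lemma eigenvalue_bound x l (b : bool) : A *m x = l *: x -> x != 0 ->
  0 < k%:R - (-1) ^+ b * l.
Proof.
move=> Ax x0; have lR := eigen_real Ax x0.
have := dirichlet_form b Ax lR.
set D := \sum_u \sum_(w | _) _; set N := \sum_u _ => def_D.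
have D0 : 0 <= D by do 2![apply: sumr_ge0 => ? _]; rewrite exprn_ge0.
have N_ge0 : 0 <= N by apply: sumr_ge0 => ? _; rewrite exprn_ge0.
have N0 : 0 < N.
  rewrite lt0r N_ge0 andbT; apply: contra_neq x0 => /eqP.
  rewrite psumr_eq0 => [/allP G0|u _]; last by rewrite exprn_ge0.
  apply: ext0_eq0 => u; apply/eqP; have := G0 u (mem_index_enum u).
  by rewrite sqrf_eq0 normr_eq0.
have : 0 <= 2 * (k%:R - (-1) ^+ b * l) by rewrite -(pmulr_lge0 _ N0) -def_D.
rewrite pmulr_rge0 // le_eqVlt => /predU1P[/esym kl0|//].
move: def_D; rewrite kl0 mulr0 mul0r => /eqP.
rewrite psumr_eq0 => [/allP edge0|u _]; last first.
  by apply: sumr_ge0 => ? _; rewrite exprn_ge0.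
have step u w : e u w -> ext0 x w = 0 -> ext0 x u = 0.
  move=> euw xw; have := edge0 u (mem_index_enum u).
  rewrite psumr_eq0 => [/allP/(_ w (mem_index_enum w))|? _]; last by rewrite exprn_ge0.
  by rewrite euw sqrf_eq0 normr_eq0 xw mulr0 subr0 => /eqP.
case/eqP: x0; apply: ext0_eq0 => u; have /connectP[p] := conn_e u a.
elim: p u => [|w p IHp] u /= => [_ <-|/andP[euw pw] def_a]; first exact: ext0_marked.
by apply: step euw _; apply: IHp.
Qed.

Lemma eigenvalue_mem_bound l : l \in eigenvalues A ->
  [/\ l \is Num.real, 0 < k%:R - l & 0 < k%:R + l].
Proof.
rewrite mem_eigenvalues.
have -> : (l \in eigenvalue A) = eigenvalue A l by [].
move=> /eigenvalueP[r rA r0].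
have Ax : A *m r^T = l *: r^T.
  rewrite -[A in LHS]trmxK -trmx_mul -linearZ /= -rA; congr (_ *m _)^T.
  by rewrite -[RHS]adjacency_trC; apply/matrixP => i j; rewrite !mxE conjC_nat.
have x0 : r^T != 0 by apply: contra_neq r0 => /(congr1 trmx); rewrite trmxK trmx0.
split; first exact: eigen_real Ax x0.
  by have := eigenvalue_bound false Ax x0; rewrite mul1r.
by have := eigenvalue_bound true Ax x0; rewrite mulN1r opprK.
Qed.

(** Real values are part of the definition because reality and dependence on
    the distance pass to eigencomponents by the same argument. *)
Definition radial (x : 'cV[C]_#|others a|) : Prop :=
  exists phi : nat -> C, (forall d, phi d \is Num.real) /\
    forall s, entry x s = phi (gdist e a (val s)).

(** At distance [i] from [a], a vertex has [p j 1 i] neighbours at distance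
    [j] from [a]; the index [j = 0] is left out because that neighbour would be
    [a] itself, where the extended vector is 0. *)
Lemma radial_adjacency x : distance_regular e -> radial x -> radial (A *m x).
Proof.
move=> [_ [p dr]] [phi [phiR x_phi]].
exists (fun i => \sum_(j < #|T|.+1 | j != 0 :> nat) phi j * (p j 1%N i)%:R); split.
  by move=> i; apply: sum_real => j _; rewrite realM ?realn.
move=> s; rewrite adjacency_entry.
have xw w : ext0 x w =
    \sum_(j < #|T|.+1 | j != 0 :> nat) phi j * (gdist e a w == j)%:R.
  have [-> | wa] := eqVneq w a.
    rewrite ext0_marked big1 // => j j0.
    have /eqP -> : gdist e a a == 0%N by rewrite gdist_eq0.
    by rewrite eq_sym (negPf j0) mulr0.
  pose s' : others a := exist (fun w => w != a) w wa.
  have jP : (gdist e a w < #|T|.+1)%N by rewrite ltnS gdist_le.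
  rewrite -[w]/(val s') ext0_val x_phi /= (bigD1 (Ordinal jP)) /=; last first.
    by rewrite gdist_eq0 // eq_sym.
  rewrite eqxx mulr1 big1 ?addr0 // => j /andP[_ ne].
  by rewrite -[_ == _ :> nat]/(Ordinal jP == j) eq_sym (negPf ne) mulr0.
under eq_bigr => w _ do rewrite xw.
rewrite exchange_big /=; apply: eq_bigr => j _; rewrite -mulr_sumr; congr (_ * _).
rewrite -(dr _ _ _ a (val s) erefl) -[X in _ = X%:R]sum1_card natr_sum.
rewrite [RHS]big_mkcond [LHS]big_mkcond.
apply: eq_bigr => w _; rewrite inE gdist_eq1 // andbC.
by case: (e _ w) => //=; case: eqP.
Qed.

(** The all-ones vector is radial, and radial vectors form a real subspace
    stable under the adjacency matrix. *)
Lemma radial_eigenproj l : distance_regular e -> l \in eigenvalues A ->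
  radial (eigenproj A l *m const_mx 1).
Proof.
move=> dr lA; have nA := adjacency_normal.
pose y l := eigenproj A l *m (const_mx 1 : 'cV[C]_#|others a|).
apply: (@eigencomponent_stable _ _ radial A (eigenvalues A) y) lA => //.
- move=> x z [phi [phiR x_phi]] [psi [psiR z_psi]].
  exists (fun d => phi d + psi d); split=> [d|s]; first by rewrite realD.
  by rewrite entryD x_phi z_psi.
- move=> c x cR [phi [phiR x_phi]].
  exists (fun d => c * phi d); split=> [d|s]; first by rewrite realM.
  by rewrite entryZ x_phi.
- by move=> x; apply: radial_adjacency.
- exact: undup_uniq.
- by move=> m /eigenvalue_mem_bound[].
- by move=> m _; apply: eigenproj_eigen.
rewrite /y sum_eigenproj //.
by exists (fun=> 1); split=> [d|s]; rewrite ?real1 ?entry_const.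
Qed.

End Deleted.

(** * Eigenvalues and eigenvectors of the walk *)

Section Phase.
Variables (C : numClosedFieldType) (k : nat).

(** The two roots [z] of [z ^ 2 - (2 l / k) z + 1]. *)
Definition phase (l : C) (b : bool) : C :=
  (l + (-1) ^+ b * 'i * sqrtC (k%:R ^+ 2 - l ^+ 2)) / k%:R.

(** The coordinates of [s + t] on the two vectors [s - z * t], for [z] the two
    phases of [l]; see [amplitude_sum]. *)
Definition amplitude (l : C) (b : bool) : C :=
  - (1 + (phase l b)^*) / (phase l b - (phase l b)^*).

Variables (l : C).
Hypotheses (lR : l \is Num.real) (ltlk : 0 < k%:R - l) (ltkl : 0 < k%:R + l).

Lemma valency_gt0 : 0 < k%:R :> C.
Proof.
have : 0 < (k%:R - l) + (k%:R + l) by rewrite addr_gt0.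
by rewrite addrC addrACA addrN addr0 -mulr2n pmulrn_lgt0.
Qed.

Lemma phase_conj b : (phase l b)^* = phase l (~~ b).
Proof.
have sR : sqrtC (k%:R ^+ 2 - l ^+ 2) \is Num.real.
  by rewrite ger0_real // sqrtC_ge0 subr_sqr mulr_ge0 // ltW.
rewrite /phase rmorphM rmorphD !rmorphM /= fmorphV /= conjC_nat conjCi
  (CrealP lR) (CrealP sR).
by rewrite rmorphXn /= rmorphN1; case: b; rewrite /= ?expr0 ?expr1; congr (_ / _); ring.
Qed.

Lemma phaseD b : phase l b + (phase l b)^* = 2 * l / k%:R.
Proof.
have k0 : k%:R != 0 :> C by rewrite gt_eqF ?valency_gt0.
by rewrite phase_conj /phase; case: b; rewrite /= ?expr0 ?expr1; field.
Qed.

Lemma phaseM b : phase l b * (phase l b)^* = 1.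
Proof.
have k0 : k%:R != 0 :> C by rewrite gt_eqF ?valency_gt0.
rewrite phase_conj /phase; set s := sqrtC _.
have s2 : s ^+ 2 = k%:R ^+ 2 - l ^+ 2 by rewrite sqrtCK.
have i2 : 'i ^+ 2 = -1 :> C by rewrite sqrCi.
transitivity ((l ^+ 2 - 'i ^+ 2 * s ^+ 2) / k%:R ^+ 2).
  by case: b; rewrite /= ?expr0 ?expr1; field.
by rewrite i2 s2; field.
Qed.

Lemma phase_sqr b : 1 + phase l b ^+ 2 = 2 * l / k%:R * phase l b.
Proof. by rewrite -(phaseD b) -(phaseM b); ring. Qed.

(** By [z * z^* = 1], this is [4 - (z + z^* ) ^ 2]. *)
Lemma norm_phaseB b :
  `|phase l b - (phase l b)^*| ^+ 2 = 4 * (k%:R - l) * (k%:R + l) / k%:R ^+ 2.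
Proof.
have k0 : k%:R != 0 :> C by rewrite gt_eqF ?valency_gt0.
rewrite normCK rmorphB /= conjCK.
transitivity (4 * (phase l b * (phase l b)^*) - (phase l b + (phase l b)^*) ^+ 2); first by ring.
by rewrite phaseM phaseD; field.
Qed.

Lemma phaseB_neq0 b : phase l b - (phase l b)^* != 0.
Proof.
rewrite -normr_eq0 -sqrf_eq0 norm_phaseB gt_eqF //.
by rewrite !mulr_gt0 // ?invr_gt0 ?exprn_gt0 ?valency_gt0 ?ltr0n.
Qed.

Lemma phase_neqN1 b : phase l b != -1.
Proof.
apply/eqP => z1; have := phaseB_neq0 b.
by rewrite z1 rmorphN1 subrr eqxx.
Qed.

Lemma norm_amplitude b : `|amplitude l b| ^+ 2 = k%:R / (2 * (k%:R - l)).
Proof.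
have k0 : k%:R != 0 :> C by rewrite gt_eqF ?valency_gt0.
have [n1 n2] : k%:R - l != 0 /\ k%:R + l != 0 by rewrite !gt_eqF.
rewrite /amplitude normrM normfV normrN exprMn exprVn norm_phaseB.
have -> : `|1 + (phase l b)^*| ^+ 2 = 2 * (k%:R + l) / k%:R.
  rewrite normCK rmorphD rmorph1 /= conjCK.
  transitivity (1 + phase l b * (phase l b)^* + (phase l b + (phase l b)^*)); first by ring.
  by rewrite phaseM phaseD; field.
by field; rewrite k0 n1 n2.
Qed.

Lemma norm_phase b : `|phase l b| ^+ 2 = 1.
Proof. by rewrite normCK phaseM. Qed.

Lemma amplitude_sum (s t : C) :
  \sum_(b <- [:: true; false]) amplitude l b * (s - phase l b * t) = s + t.
Proof.
rewrite !big_cons big_nil addr0 /amplitude -(negbK false) -phase_conj /= conjCK.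
have := phaseB_neq0 true; set z := phase l true => z0.
by field; rewrite [X in _ && X]z0 andbT subr_eq0 eq_sym -subr_eq0.
Qed.

End Phase.

(** The sum of a phase and its conjugate recovers [l]. *)
Lemma phase_inj (C : numClosedFieldType) (k : nat) (l m : C) (b c : bool) :
  l \is Num.real -> 0 < k%:R - l -> 0 < k%:R + l ->
  m \is Num.real -> 0 < k%:R - m -> 0 < k%:R + m ->
  phase k l b = phase k m c -> (l, b) = (m, c).
Proof.
move=> lR l1 l2 mR m1 m2 eq_ph.
have k0 : k%:R != 0 :> C by rewrite gt_eqF ?(valency_gt0 l1 l2).
have lm : l = m.
  have := phaseD lR l1 l2 b; rewrite eq_ph (phaseD mR m1 m2) => E.
  apply/esym; transitivity (2 * m / k%:R * k%:R / 2); first by field.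
  by rewrite E; field.
case: _ / lm in eq_ph *; congr (_, _).
have := phaseB_neq0 lR l1 l2 b; rewrite phase_conj // eq_ph subr_eq0.
by case: b c {eq_ph} => [] [] //=; rewrite eqxx.
Qed.

Section Walk.
Variables (C : numClosedFieldType) (T : finType) (e : rel T) (k : nat) (a : T).
Hypotheses (simple_e : simple_graph e) (reg_e : regular e k) (k_gt0 : (0 < k)%N).

Let U := transition C e k a.

Lemma reg_sum_const (c : C) u : \sum_(w | e u w) c = k%:R * c.
Proof.
rewrite sumr_const mulr_natl -(reg_e u); congr (_ *+ _).
by apply: eq_card => w; rewrite !inE.
Qed.

(** At a head other than [a] this is the relation between [z] and [l].  At
    the head [a] the function is constant on the arcs leaving [a], with the value
    [- z * gam], so the reflection fixes it and only the sign change of the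
    marked vertex remains. *)
Lemma transition_eigen (G : T -> C) (l z gam : C) :
  G a = 0 -> (forall w, e a w -> G w = gam) ->
  (forall u, u != a -> \sum_(w | e u w) G w = l * G u) ->
  1 + z ^+ 2 = 2 * l / k%:R * z ->
  let y := vec (fun p : arc e => G (tail p) - z * G (head p)) in
  U *m y = z *: y.
Proof.
move=> Ga Gn Gs zE /=; apply: entry_inj => p.
have k0 : k%:R != 0 :> C by rewrite pnatr_eq0 -lt0n.
rewrite entryZ (transition_vec k a simple_e (fun u w => G u - z * G w)) entry_vec.
rewrite sumrB reg_sum_const -mulr_sumr.
have [hp | hp] := eqVneq (head p) a.
  have tp : G (tail p) = gam by apply: Gn; rewrite -hp; apply: rev_arc_subproof.
  have -> : \sum_(w | e (head p) w) G w = k%:R * gam.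
    by rewrite -(reg_sum_const gam (head p)); apply: eq_bigr => w; rewrite hp => /Gn.
  by rewrite hp Ga tp; field.
rewrite Gs // mul1r.
transitivity (G (head p) - 2 * l / k%:R * z * G (head p) + z * G (tail p)); first by field.
by rewrite -zE; ring.
Qed.

(** Away from [a] the reflection subtracts a zero average, leaving minus the
    reversed function, and the function is symmetric.  At the head [a] the
    function is constant on the arcs leaving [a], and the minus sign is that of
    the marked vertex. *)
Lemma transition_eigenN1 (G : T -> C) (gam : C) :
  G a = 0 -> (forall w, e a w -> G w = gam) ->
  (forall u, u != a -> \sum_(w | e u w) (1 - G u - G w) = 0) ->
  let y := vec (fun p : arc e => 1 - G (tail p) - G (head p)) in
  U *m y = -1 *: y.
Proof.
move=> Ga Gn Gs /=; apply: entry_inj => p.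
have k0 : k%:R != 0 :> C by rewrite pnatr_eq0 -lt0n.
rewrite entryZ (transition_vec k a simple_e (fun u w => 1 - G u - G w)) entry_vec.
have [hp | hp] := eqVneq (head p) a; last first.
  by rewrite Gs //; ring.
have tp : G (tail p) = gam by apply: Gn; rewrite -hp; apply: rev_arc_subproof.
have -> : \sum_(w | e (head p) w) (1 - G (head p) - G w) = k%:R * (1 - gam).
  rewrite -(reg_sum_const (1 - gam) (head p)); apply: eq_bigr => w.
  by rewrite hp Ga subr0 => /Gn ->.
by rewrite hp Ga tp; field.
Qed.

End Walk.

(** * The average search probability *)

Theorem theorem6p2 (C : numClosedFieldType) (T : finType) (e : rel T)
    (n k : nat) (a : T) (v : others a)
    (simple_e : simple_graph e) (card_T : #|T| = n)
    (dr_e : distance_regular e) (reg_e : regular e k) (k_ge2 : (2 <= k)%N)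
    (adj_av : e a (val v)) :
  let A : 'M[C]_#|others a| := adjacency C (del_vertex e (a := a)) in
  let E (l : C) := eigenproj A l in
  avg_search_prob C e k a =
    n%:R^-1 * (\sum_(l <- eigenvalues A)
       k%:R ^+ 3 / ((k%:R - l) * (k%:R + l) ^+ 2)
         * entry (E l *m const_mx 1) v ^+ 2)
    + n%:R^-1 * (1 - \sum_(l <- eigenvalues A)
                       k%:R / (k%:R + l) * entry (E l *m const_mx 1) v) ^+ 2.
Proof.
move=> A E.
have conn_e : connected e := proj1 dr_e.
have k_gt0 : (0 < k)%N := ltnW k_ge2.
have k0 : k%:R != 0 :> C by rewrite pnatr_eq0 -lt0n.
have n0 : n%:R != 0 :> C.
  by rewrite -card_T pnatr_eq0 -lt0n; apply/card_gt0P; exists a.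
have nA : A \is normalmx := adjacency_normal C a simple_e.
have bnd l : l \in eigenvalues A -> [/\ l \is Num.real, 0 < k%:R - l & 0 < k%:R + l].
  exact: eigenvalue_mem_bound simple_e conn_e reg_e l.
pose g l : 'cV[C]_#|others a| := E l *m const_mx 1; pose G l := ext0 (g l).
have Gv l : G l (val v) = entry (g l) v by apply: ext0_val.
have Ga l : G l a = 0 by apply: ext0_marked.
have [Gn GR] : (forall l w, l \in eigenvalues A -> e a w -> G l w = G l (val v)) /\
    (forall l, l \in eigenvalues A -> G l (val v) \is Num.real).
  have rad l := radial_eigenproj simple_e conn_e reg_e dr_e (l := l).
  split=> [l w|l] /rad[phi [phiR phiE]]; last by rewrite Gv phiE.
  move=> eaw; have wa : w != a by apply: contraTneq eaw => ->; case: simple_e => _ ->.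
  rewrite Gv -[w]/(val (exist (fun w => w != a) w wa : others a)) /G ext0_val !phiE.
  have d1 u : e a u -> gdist e a u = 1%N by move=> au; apply/eqP; rewrite gdist_eq1.
  by congr phi; rewrite (d1 _ adj_av); exact: d1.
have Gs l u : u != a -> \sum_(w | e u w) G l w = l * G l u.
  by apply: ext0_eigen; apply: eigenproj_eigen.
have G1 u : u != a -> \sum_(l <- eigenvalues A) G l u = 1.
  move=> ua; rewrite -[u]/(val (exist (fun w => w != a) u ua : others a)).
  under eq_bigr => l _ do rewrite /G ext0_val.
  by rewrite -entry_sum sum_eigenproj // entry_const.
(* The coefficient [k / (k + l)] is forced: the sum of [g_l (tail p) + g_l (head
   p)] over the arcs leaving a vertex [u] other than [a] is [(k + l) * g_l u], and
   that of the all-ones function is [k]. *)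
pose coef (l : C) : C := k%:R / (k%:R + l).
pose Phi u := \sum_(l <- eigenvalues A) coef l * G l u.
pose c0 : C := (sqrtC (#|T| * k)%:R)^-1.
have c0E : `|c0| ^+ 2 = (n%:R * k%:R)^-1.
  by rewrite normfV exprVn -normrX sqrtCK ger0_norm ?ler0n // natrM card_T.
have PhiR : Phi (val v) \is Num.real.
  rewrite /Phi big_seq sum_real // => l lA; have [lR _ _] := bnd l lA.
  by rewrite realM ?GR // /coef realM ?realV ?realD ?realn.
have Phi_n w : e a w -> Phi w = Phi (val v).
  by move=> eaw; apply: eq_big_seq => l lA; rewrite Gn.
have Phi_a : Phi a = 0 by rewrite /Phi big1 // => l _; rewrite Ga mulr0.
(* The index [None] is the [-1]-part of the initial state, and [Some (l, b)]
   is the part that belongs to [l] and its phase [b]. *)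
pose nu (i : option (C * bool)) := if i is Some (l, b) then phase k l b else -1.
pose y (i : option (C * bool)) : 'cV[C]_#|arc e| := c0 *:
  if i is Some (l, b) then (coef l * amplitude k l b) *:
     vec (fun p : arc e => G l (tail p) - phase k l b * G l (head p))
  else vec (fun p : arc e => 1 - Phi (tail p) - Phi (head p)).
pose s := None :: [seq Some (l, b) | l <- eigenvalues A, b <- [:: true; false]].
have sP l b : Some (l, b) \in s -> l \in eigenvalues A.
  by rewrite in_cons => /predU1P[//|/allpairsP[[l' b'] [lA _ [-> _]]]].
have sumsE (V : nmodType) (F : option (C * bool) -> V) : \sum_(i <- s) F i =
    F None + \sum_(l <- eigenvalues A) \sum_(b <- [:: true; false]) F (Some (l, b)).
  by rewrite /s big_cons big_allpairs_dep.
have us : uniq s.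
  rewrite /s cons_uniq; apply/andP; split; first by apply/negP => /allpairsP[? []].
  by apply: allpairs_uniq; rewrite ?undup_uniq // => -[? ?] [? ?] _ _ [-> ->].
have nu_inj : {in s &, injective nu}.
  have nuN1 l b : Some (l, b) \in s -> phase k l b != -1.
    by move=> /sP /bnd[lR l1 l2]; apply: phase_neqN1.
  move=> [[l b]|] [[m c]|] si sj //; rewrite /nu => eq_ph.
  - have [[lR l1 l2] [mR m1 m2]] := (bnd _ (sP _ _ si), bnd _ (sP _ _ sj)).
    by rewrite (phase_inj lR l1 l2 mR m1 m2 eq_ph).
  - by have := nuN1 _ _ si; rewrite eq_ph eqxx.
  - by have := nuN1 _ _ sj; rewrite -eq_ph eqxx.
have x0E : initial_state C e k = \sum_(i <- s) y i.
  rewrite sumsE; apply: entry_inj => p.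
  rewrite entryD entry_sum /initial_state entryZ entry_const mulr1 entryZ entry_vec.
  rewrite [X in _ + X](_ : _ = c0 * (Phi (tail p) + Phi (head p))).
    by rewrite -mulrDr -[LHS]mulr1; congr (_ * _); ring.
  rewrite -big_split mulr_sumr; apply: eq_big_seq => l lA /=.
  have [lR l1 l2] := bnd l lA.
  rewrite -mulrDr -(amplitude_sum lR l1 l2) entry_sum !mulr_sumr.
  by apply: eq_bigr => b _; rewrite !entryZ entry_vec; ring.
have nU : transition C e k a \is normalmx := transition_normal C a simple_e reg_e k_gt0.
have Uy : {in s, forall i, transition C e k a *m y i = nu i *: y i}.
  move=> [[l b]|] /= si; rewrite -!scalemxAr.
    have lA := sP l b si; have [lR l1 l2] := bnd l lA.
    rewrite (transition_eigen simple_e reg_e k_gt0 (Ga l) (fun w => Gn l w lA) (Gs l)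
      (phase_sqr lR l1 l2 b)).
    by rewrite !scalerA; congr (_ *: _); ring.
  rewrite (transition_eigenN1 simple_e reg_e k_gt0 Phi_a Phi_n) => [|u ua].
    by rewrite !scalerA mulrC.
  rewrite !sumrB !(reg_sum_const reg_e).
  have -> : \sum_(w | e u w) Phi w = \sum_(l <- eigenvalues A) coef l * (l * G l u).
    by rewrite exchange_big /=; apply: eq_bigr => l _; rewrite -mulr_sumr Gs.
  (* Expanding [1] at [u] in the components [G l u], the coefficient of each of
     them is [k - (k + l) * coef l = 0]. *)
  rewrite -[X in k%:R * X](G1 u ua) -mulrBr -sumrB mulr_sumr -sumrB.
  rewrite big_seq big1 // => l lA; have [lR l1 l2] := bnd l lA.
  have n2 : k%:R + l != 0 by rewrite gt_eqF.
  by rewrite /coef; field.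
rewrite /avg_search_prob x0E.
pose norm2 p (x : 'cV[C]_#|arc e|) := `|entry x p| ^+ 2.
transitivity (\sum_(p : arc e | tail p == a) \sum_(i <- s) norm2 p (y i)).
  apply: eq_bigr => p _.
  apply: (sum_over_eigencomponents (G := norm2 p) nU us nu_inj Uy).
  by rewrite /norm2 entry0 normr0 expr0n.
pose summand : C := (n%:R * k%:R)^-1 * ((1 - Phi (val v)) ^+ 2 +
  \sum_(l <- eigenvalues A) coef l ^+ 2 * (k%:R / (k%:R - l)) * G l (val v) ^+ 2).
transitivity (\sum_(p : arc e | tail p == a) summand).
  apply: eq_bigr => p /eqP tp; rewrite sumsE.
  have ahp : e a (head p) by rewrite -tp; exact: (valP p).
  rewrite /summand mulrDr; congr (_ + _).
    rewrite /norm2 entryZ entry_vec tp Phi_a (Phi_n _ ahp) subr0 normrM exprMn c0E.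
    by rewrite real_normK // realB ?real1.
  rewrite mulr_sumr; apply: eq_big_seq => l lA; have [lR l1 l2] := bnd l lA.
  have n1 : k%:R - l != 0 by rewrite gt_eqF.
  have E1 b : norm2 p (y (Some (l, b))) = (n%:R * k%:R)^-1 *
      (coef l ^+ 2 * (k%:R / (2 * (k%:R - l))) * G l (val v) ^+ 2).
    rewrite /norm2 !entryZ entry_vec tp Ga sub0r (Gn l _ lA ahp).
    have cR : coef l \is Num.real by rewrite /coef realM ?realV ?realD ?realn.
    have [aE zE] := (norm_amplitude lR l1 l2 b, norm_phase lR l1 l2 b).
    move: (coef l) (amplitude k l b) (phase k l b) cR aE zE => c am z cR aE zE.
    by rewrite !normrM normrN normrM !exprMn c0E aE zE !real_normK ?GR // mul1r.
  by rewrite !big_cons big_nil !E1; field; rewrite n1 k0 n0.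
rewrite sumr_const -[X in _ *+ X]/(#|[pred q : arc e | tail q == a]|) (card_tail reg_e).
rewrite -[summand *+ k]mulr_natl /summand -mulrDr [X in k%:R * (_ * X)]addrC mulrA.
have -> : k%:R * (n%:R * k%:R)^-1 = n%:R^-1 :> C by field; rewrite k0 n0.
congr (_ * (_ + _)).
  apply: eq_big_seq => l lA; have [lR l1 l2] := bnd l lA.
  have [n1 n2] : k%:R - l != 0 /\ k%:R + l != 0 by rewrite !gt_eqF.
  by rewrite Gv /coef; field; rewrite n1 n2.
by congr ((1 - _) ^+ 2); apply: eq_bigr => l _; rewrite Gv.
Qed.
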